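(* Let $k\ge 4$ be an even integer and let $G$ be a finite group of even order. Assume that every prime power dividing $|G|$ either divides $k$ or is relatively prime to $k(k-1)$. Then there are infinitely many integers $v$ for which there exists a $2$-$(v,k,1)$-design whose automorphism group has a subgroup isomorphic to $G$.
   Context: A $2$-$(v,k,1)$-design consists of a set of $v$ points together with a collection of $k$-element subsets of the points (called blocks) such that any two distinct points lie in exactly one block. An automorphism is a permutation of the points mapping the set of blocks onto itself. *)

(* Defs.v *)
From HB Require Import structures.
From mathcomp Require Import all_boot all_fingroup.

Set Implicit Arguments.
Unset Strict Implicit.
Unset Printing Implicit Defensive.

(* The 2-(v, k, 1)-designs on the point set T, where v = #|T|. *)
Definition is_design (T : finType) (k : nat) (B : {set {set T}}) : Prop :=
  (forall b : {set T}, b \in B -> #|b| = k) /\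
  (forall x y : T, x != y ->
     exists! b : {set T}, [/\ b \in B, x \in b & y \in b]).

Definition design_aut (T : finType) (B : {set {set T}}) : {set {perm T}} :=
  [set s : {perm T} | [set s @: b | b : {set T} in B] == B].

Lemma design_aut_group_set (T : finType) (B : {set {set T}}) :
  group_set (design_aut B).
Proof.
have imM (s t : {perm T}) (b : {set T}) : (s * t)%g @: b = t @: (s @: b).
  by rewrite -imset_comp; apply: eq_imset => x; rewrite /= permM.
apply/group_setP; split.
  rewrite inE; apply/eqP; rewrite -[RHS]imset_id; apply: eq_imset => b.
  by rewrite -[RHS]imset_id; apply: eq_imset => x; rewrite perm1.
move=> s t; rewrite !inE => /eqP sB /eqP tB; apply/eqP.
rewrite -[RHS]tB -[in RHS]sB -imset_comp.
by apply: eq_imset => b; rewrite /= imM.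
Qed.

Canonical design_aut_group (T : finType) (B : {set {set T}}) : {group {perm T}} :=
  Group (design_aut_group_set B).

(* Main.v *)
Require Import Defs.
From mathcomp Require Import all_boot all_fingroup all_algebra all_solvable all_field.
From mathcomp Require Import zify ring.

(** Write [k = 2h]. Let [Z] be a large finite field carrying both a 2-(|Z|,h,1)-design [L] and a
    2-(|Z|,k,1)-design [D], and let [e] be the number of blocks of [L] through a point. Let [F] be
    a large finite field with [|F| - 1 = e m], where [m] is even and divisible by the group order,
    and let [V] be the space of [F]-valued functions on the group. The class of [a] in [F^*] is
    [a^m], an [e]-th root of unity. Since a scalar induced by a group element has class 1, there is
    a group-invariant [Cl] on [V \ 0] with [Cl (a v) = a^m Cl v]. The points are [Z * V]; with [w]
    running over the vectors of class 1, the blocks are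
      - [d * {p}] for [d] in [D];
      - [{(z, p + x_S(z) w), (z, p - x_S(z) w) : z in S}] for [S] in [L];
      - [{(z, p + y_i(z) w) : z in d}] for [d] in [D] and [i < e - 2].
    The pairs [(z, v), (z, v')] are covered once if the [x_S(z)], [S] through [z], represent each
    class once. The pairs [(z, v), (z', v')] are covered once if the [e] elements
    [x_S(z) + x_S(z')], [x_S(z) - x_S(z')] (with [S] the block of [L] through [z, z']) and
    [y_i(z) - y_i(z')] represent each class once.
    Such [x], [y] are found greedily, because for a set [A] in [F] and most [t] in [F] the classes
    are almost uniformly distributed on [A - t] (a second moment bound). The same greedy argument
    gives difference families, hence [L] and [D]. *)

Set Implicit Arguments.
Unset Strict Implicit.
Unset Printing Implicit Defensive.

Import GRing.Theory.

(** * Power classes in a finite field *)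

Section PowerClasses.

Variables (F : finFieldType) (e m : nat).
Hypotheses (e_gt0 : 0 < e) (m_gt0 : 0 < m) (cardF : #|F| = (e * m).+1).

Local Open Scope ring_scope.

Definition classes (F : finFieldType) (e : nat) : {set F} := [set c | c ^+ e == 1].

Lemma expf_pred_card (x : F) : x != 0 -> x ^+ (e * m) = 1.
Proof.
by move=> x0; apply: (mulfI x0); rewrite -exprS -cardF expf_card mulr1.
Qed.

Lemma class_in (x : F) : x != 0 -> x ^+ m \in classes F e.
Proof. by move=> x0; rewrite inE -exprM mulnC expf_pred_card. Qed.

Lemma classes_neq0 (c : F) : c \in classes F e -> c != 0.
Proof.
rewrite inE; apply: contraTneq => ->.
by rewrite expr0n (gtn_eqF e_gt0) eq_sym oner_eq0.
Qed.

Lemma class_neq0 (x : F) : x ^+ m \in classes F e -> x != 0.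
Proof. by move/classes_neq0; apply: contraNneq => ->; rewrite expr0n (gtn_eqF m_gt0). Qed.

Lemma card_roots_le (n : nat) (c : F) : (0 < n)%N -> (#|[set x : F | x ^+ n == c]| <= n)%N.
Proof.
move=> n0.
have p0 : 'X^n - c%:P != 0 :> {poly F} by rewrite -size_poly_gt0 size_XnsubC.
have := max_poly_roots p0 (rs := enum [set x : F | x ^+ n == c]).
rewrite size_XnsubC // ltnS -cardE enum_uniq; apply=> //.
apply/allP => x; rewrite mem_enum inE => /eqP <-.
by rewrite rootE !hornerE subrr.
Qed.

(** A polynomial has no more roots than its degree, so there are at most [e] classes and each has at
    most [m] elements. Together they hold all [e * m] nonzero elements, so both bounds are
    attained. *)
Lemma class_counts :
  #|classes F e| = e /\
  {in classes F e, forall c, #|[set x : F | x ^+ m == c]| = m}.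
Proof.
have le_cl : (#|classes F e| <= e)%N by apply: card_roots_le.
have le_m c : (#|[set x : F | x ^+ m == c]| <= m)%N by apply: card_roots_le.
have tot : (e * m = \sum_(c in classes F e) #|[set x : F | x ^+ m == c]|)%N.
  have -> : (e * m)%N = #|[set x : F | x != 0]|.
    rewrite -[LHS]/((e * m)%N.+1.-1) -cardF -(cardsC1 0).
    by apply: eq_card => x; rewrite !inE.
  rewrite -sum1_card (partition_big (fun x => x ^+ m) (mem (classes F e))) /=; last first.
    by move=> x; rewrite inE => /class_in.
  apply: eq_bigr => c cC; rewrite -sum1_card; apply: eq_bigl => x; rewrite !inE.
  by apply: andb_idl => /eqP E; apply: class_neq0; rewrite E.
have le1 : (\sum_(c in classes F e) #|[set x : F | x ^+ m == c]| <= #|classes F e| * m)%N.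
  by rewrite -sum_nat_const; apply: leq_sum.
have clE : #|classes F e| = e by nia.
split=> // c cC; apply/eqP; rewrite eqn_leq le_m /= leqNgt; apply/negP => lt.
have : (\sum_(c in classes F e) #|[set x : F | x ^+ m == c]| < \sum_(c in classes F e) m)%N.
  rewrite (bigD1 c) //= [X in (_ < X)%N](bigD1 c) //= -addSn.
  by apply: leq_add => //; apply: leq_sum.
by rewrite sum_nat_const -tot clE ltnn.
Qed.

Local Close Scope ring_scope.

(** * Second moment of the class counts on translates of a set *)

Section Variance.

Variable A : {set F}.

Let nc (x c : F) := #|[set a in A | ((a - x) ^+ m == c)%R]|.

Let ncE x c : nc x c = \sum_(a in A) ((a - x) ^+ m == c)%R.
Proof.
rewrite /nc -sum1_card [RHS]big_mkcond [LHS]big_mkcond; apply: eq_bigr => a _.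
by rewrite inE; case: (a \in A); case: eqP.
Qed.

Let card_shift (a c : F) : c \in classes F e -> \sum_x ((a - x) ^+ m == c)%R = m.
Proof.
move=> cC; rewrite -[RHS](class_counts.2 _ cC) -sum1_card big_mkcond /=.
rewrite (reindex_inj (h := fun x => (a - x)%R)) /=; last first.
  by move=> x y /addrI /oppr_inj.
by rewrite [RHS]big_mkcond; apply: eq_bigr => x _; rewrite inE opprB addrC subrK; case: eqP.
Qed.

Let sum_nc : \sum_x \sum_(c in classes F e) nc x c = e * (#|A| * m).
Proof.
rewrite exchange_big -[X in X * _]class_counts.1 -sum_nat_const.
apply: eq_bigr => c cC; under eq_bigr do rewrite ncE.
rewrite exchange_big -sum_nat_const; apply: eq_bigr => a _; exact: card_shift.
Qed.

Let pair_count (a b : F) :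
  \sum_x \sum_(c in classes F e) ((a - x) ^+ m == c)%R * ((b - x) ^+ m == c)%R
    <= (a == b) * (e * m) + m.
Proof.
have [<-|ab] := eqVneq a b.
  rewrite mul1n; apply: leq_trans (leq_addr _ _).
  rewrite exchange_big -[X in _ <= X * _]class_counts.1 -sum_nat_const leq_sum // => c cC.
  rewrite -[X in _ <= X](card_shift a cC) leq_sum // => x _; by case: eqP.
rewrite mul0n add0n.
pose S := [set x | (b - x != 0)%R && ((a - x) ^+ m == (b - x) ^+ m)%R].
have le1 : \sum_x \sum_(c in classes F e) ((a - x) ^+ m == c)%R * ((b - x) ^+ m == c)%R <= #|S|.
  rewrite -sum1_card [X in _ <= X]big_mkcond leq_sum // => x _.
  case: (boolP (((b - x) ^+ m)%R \in classes F e)) => bC; last first.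
    rewrite big1 // => c cC; have [E|] := eqVneq ((b - x) ^+ m)%R c; last by rewrite muln0.
    by rewrite E cC in bC.
  rewrite (bigD1 _ bC) /= eqxx muln1 big1 ?addn0; last first.
    by move=> c /andP[_ /negPf cb]; rewrite [(_ ^+ m == c)%R in X in _ * X]eq_sym cb muln0.
  by rewrite inE (class_neq0 bC) /=; case: eqP.
apply: leq_trans le1 _.
have inj : {in S &, injective (fun x => ((a - x) / (b - x))%R)}.
  move=> x y; rewrite !inE => /andP[bx _] /andP[by_ _] /eqP.
  rewrite eqr_div // => /eqP E.
  have : ((a - b) * (x - y) = 0)%R.
    have -> : ((a - b) * (x - y) = (a - x) * (b - y) - (a - y) * (b - x))%R by ring.
    by rewrite E subrr.
  by move/eqP; rewrite mulf_eq0 !subr_eq0 (negPf ab) => /eqP.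
rewrite -(card_in_imset inj); apply: leq_trans (card_roots_le 1%R m_gt0).
apply/subset_leq_card/subsetP => y /imsetP[x]; rewrite !inE => /andP[bx /eqP E] ->.
by rewrite expr_div_n E divff // expf_neq0.
Qed.

Let sum_nc2 :
  \sum_x \sum_(c in classes F e) nc x c * nc x c <= #|A| * (e * m) + #|A| * #|A| * m.
Proof.
have -> : \sum_x \sum_(c in classes F e) nc x c * nc x c =
  \sum_(a in A) \sum_(b in A) \sum_x \sum_(c in classes F e)
     ((a - x) ^+ m == c)%R * ((b - x) ^+ m == c)%R.
  under eq_bigr => x _ do under eq_bigr => c _ do rewrite !ncE big_distrlr.
  under eq_bigr => x _ do rewrite exchange_big.
  rewrite exchange_big; apply: eq_bigr => a _.
  under eq_bigr => x _ do rewrite exchange_big.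
  by rewrite exchange_big.
rewrite -mulnA -mulnDr -sum_nat_const leq_sum // => a aA.
apply: (@leq_trans (\sum_(b in A) ((a == b) * (e * m) + m))).
  by apply: leq_sum => b _; apply: pair_count.
rewrite big_split /= sum_nat_const leq_add2r (bigD1 a) //= eqxx mul1n big1 ?addn0 //.
by move=> b /andP[_ /negPf ba]; rewrite eq_sym ba.
Qed.

(* For [a != b] the ratios [(a - x) / (b - x)] are pairwise distinct, so [a - x] and [b - x] are
   in the same class for at most [m] values of [x]; this bounds the second moment. *)
Lemma class_variance (c : F) : c \in classes F e ->
  #|[set x | 2 * e * #|[set a in A | ((a - x) ^+ m == c)%R]| < #|A| ]| * #|A|
    <= 8 * e ^ 2 * #|F|.
Proof.
move=> cC; set bad := [set x | _].
(* The squared deviation of [e * nc x c] from [#|A|]: subtraction is truncated, so one of the two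
   summands is always 0. *)
pose w x c := (e * nc x c - #|A|) ^ 2 + (#|A| - e * nc x c) ^ 2.
have wE x c' : w x c' + 2 * e * #|A| * nc x c' = e ^ 2 * (nc x c' * nc x c') + #|A| ^ 2.
  rewrite /w; have [le|le] := leqP (e * nc x c') #|A|; nia.
have : \sum_x \sum_(c in classes F e) (w x c + 2 * e * #|A| * nc x c) =
       \sum_x \sum_(c in classes F e) (e ^ 2 * (nc x c * nc x c) + #|A| ^ 2).
  by apply: eq_bigr => x _; apply: eq_bigr => c' _.
under eq_bigr => x _ do rewrite big_split -big_distrr.
under [RHS]eq_bigr => x _ do rewrite big_split -big_distrr sum_nat_const class_counts.1 /=.
rewrite !big_split sum_nat_const -!big_distrr /= sum_nc => wtot.
(* At a bad [x], [e * nc x c] is less than half of [#|A|], so the deviation at [c] alone is at least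
   [#|A| ^ 2 / 4]. *)
have lebad : #|bad| * #|A| ^ 2 <= 4 * \sum_x \sum_(c in classes F e) w x c.
  rewrite -sum_nat_const big_distrr /= big_mkcond leq_sum // => x _.
  case: ifP => //; rewrite inE -/(nc x c) => lt.
  rewrite (bigD1 c) //= mulnDr; apply: leq_trans (leq_addr _ _).
  have le2 : #|A| <= 2 * (#|A| - e * nc x c) by move: lt; rewrite -mulnA; lia.
  rewrite /w; move: {lt} #|A| (e * nc x c - #|A|) (#|A| - e * nc x c) le2 => a t u; nia.
have leA : #|A| <= #|F| by apply: max_card.
have [->|A0] := posnP #|A|; first by rewrite muln0.
move: sum_nc2 wtot lebad; rewrite -/bad.
have -> : #|{: F}| = (e * m).+1 by rewrite -cardF.
move: leA A0; rewrite cardF.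
set S2 := \sum_x _; set W := \sum_x _.
move: #|A| #|bad| W S2 => a b W S2 leA a0 le2 wtot lebad.
have le3 : e ^ 2 * S2 <= e ^ 2 * (a * (e * m) + a * a * m) by rewrite leq_mul2l le2 orbT.
(* The terms in [e ^ 2 * m * a ^ 2] cancel: one comes from [S2], one from the squared mean, and two
   from the cross term. *)
have W1 : W <= e ^ 3 * m * a + e * a ^ 2 by nia.
have le4 : e * a ^ 2 <= e ^ 2 * ((e * m).+1 * a).
  rewrite -!mulnn -!mulnA leq_mul2l; apply/orP; right.
  by rewrite mulnA leq_mul2r (leq_trans leA) ?orbT // leq_pmull.
have W2 : W <= 2 * e ^ 2 * (e * m).+1 * a by nia.
rewrite -(leq_pmul2r a0); nia.
Qed.

End Variance.

End PowerClasses.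

(** * Greedy embedding *)

(* Up to at most [K |T| / |A|] exceptions, each [x] is related to a proportion at least [1/D]
   of [A]. *)
Definition rich (T : finType) (D K : nat) (R : rel T) :=
  forall A : {set T},
    #|[set x | D * #|[set y in A | R x y]| < #|A|]| * #|A| <= K * #|T|.

Lemma card_le_fibers (T T' : finType) (f : T -> T') (n : nat) (A : {set T}) (B : {set T'}) :
  (forall b, #|[set x | f x == b]| <= n) -> {in A, forall x, f x \in B} -> #|A| <= #|B| * n.
Proof.
move=> fib AB; rewrite -sum1_card (partition_big f (mem B)) //= -sum_nat_const.
apply: leq_sum => b _; rewrite sum1dep_card; apply: leq_trans (fib b).
by apply/subset_leq_card/subsetP => x; rewrite !inE => /andP[].
Qed.

(** By [class_counts] with [e = 2] there are two square roots of 1, and every such root is 1 or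
    -1. *)
Lemma opp1_neq1 (F : finFieldType) : odd #|F| -> (-1 != 1 :> F)%R.
Proof.
move=> oddF; pose l := #|F|./2.
have cardF2 : #|F| = (2 * l).+1 by rewrite -[LHS]odd_double_half oddF mul2n.
have l0 : 0 < l by have := card_finNzRing_gt1 F; rewrite cardF2; lia.
apply: contra_eqN (class_counts (ltn0Sn 1) l0 cardF2).1 => /eqP E.
suff -> : classes F 2 = [set 1%R] by rewrite cards1.
by apply/setP => x; rewrite !inE -subr_eq0 subr_sqr_1 mulf_eq0 subr_eq0 addr_eq0 E orbb.
Qed.

(** * Rich relations on a finite field *)

Section FieldRelations.

Variables (F : finFieldType) (e m : nat).
Hypotheses (e_gt0 : 0 < e) (m_gt0 : 0 < m) (cardF : #|F| = (e * m).+1).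

Lemma class_rich (c : F) : c \in classes F e ->
  rich (2 * e) (8 * e ^ 2) (fun x y => (y - x) ^+ m == c)%R.
Proof. by move=> cC A; apply: class_variance. Qed.

(* If [y + x] and [y - x] have the same class then [y^2 - x^2] is a square since [e] is even;
   so the variance bound is applied to nonsquares and to the set of squares of [A]. *)
Lemma sub_squares_rich : ~~ odd e ->
  rich 8 128 (fun x y : F => [&& y + x != 0, y - x != 0 & (y + x) ^+ m != (y - x) ^+ m])%R.
Proof.
move=> e_even A.
(* [l] is half of [#|F| - 1], so by Euler's criterion its power is -1 exactly at the nonsquares. *)
pose l := (e./2 * m)%N.
have l0 : 0 < l by rewrite /l muln_gt0 m_gt0 andbT half_gt0; case: e e_gt0 e_even => [|[]].
have cardF2 : #|F| = (2 * l).+1 by rewrite cardF /l mulnA mul2n even_halfK.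
have N1in : (-1)%R \in classes F 2 by rewrite inE sqrrN expr1n.
have N1neq1 : (-1 : F)%R != 1%R by apply: opp1_neq1; rewrite cardF2 /= oddM.
have sq (a b : F) : ((a ^+ 2 - b ^+ 2) ^+ l = -1)%R ->
    [&& a + b != 0, a - b != 0 & (a + b) ^+ m != (a - b) ^+ m]%R.
  rewrite subr_sqr => E.
  have : ((a - b) * (a + b) != 0)%R.
    apply: contraTneq isT => E0; move: E; rewrite E0 expr0n (gtn_eqF l0) => /eqP.
    by rewrite eq_sym oppr_eq0 oner_eq0.
  rewrite mulf_eq0 negb_or => /andP[ab0 -> /=]; rewrite ab0 /=.
  apply: contraNneq N1neq1 => Em; rewrite -E /l mulnC exprM exprMn Em -expr2 -!exprM.
  rewrite -[X in _ == X](expf_pred_card cardF ab0); apply/eqP; congr (_ ^+ _)%R.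
  by rewrite -{2}(even_halfK e_even) -mul2n; lia.
pose A2 := [set (y ^+ 2)%R | y in A].
have fib (b : F) : #|[set x : F | (x ^+ 2 == b)%R]| <= 2 by apply: card_roots_le.
(* Squaring is at most two-to-one, here on [A] and below on the bad points. This turns the constants
   4 and 32 for two classes into 8 and 128. *)
have leA : #|A| <= #|A2| * 2.
  by apply: (card_le_fibers fib) => y yA; apply/imsetP; exists y.
set bad := [set x | _].
pose bad2 := [set t | 2 * 2 * #|[set b in A2 | ((b - t) ^+ l == -1)%R]| < #|A2| ].
have lebad : #|bad| <= #|bad2| * 2.
  apply: (card_le_fibers fib) => x; rewrite !inE => lt.
  rewrite -(ltn_pmul2r (ltn0Sn 1)); apply: leq_trans leA; apply: leq_ltn_trans lt.
  rewrite -!mulnA [(_ * 2)%N]mulnC !mulnA leq_mul2l /=.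
  apply: leq_trans (leq_imset_card (fun y => y ^+ 2)%R _).
  apply/subset_leq_card/subsetP => b; rewrite !inE => /andP[/imsetP[y yA ->] /eqP E].
  by apply/imsetP; exists y => //; rewrite inE yA sq.
have := class_variance (ltn0Sn 1) l0 cardF2 A2 N1in; rewrite -/bad2 => le2.
apply: leq_trans (leq_mul lebad leA) _.
by rewrite mulnACA; apply: leq_trans (leq_mul le2 (leqnn _)) _; rewrite mulnAC.
Qed.

End FieldRelations.

Section Embedding.

Variables (Z : finType) (D K : nat).

(* Greedy choice: at each step all but boundedly many candidates leave every remaining
   candidate set of positive density. *)
Lemma rich_embedding (s : seq Z) (a : nat) : uniq s ->
  exists Q, forall (T : finType) (R : Z -> Z -> rel T) (A : Z -> {set T}),
    Q <= #|T| -> (forall i j x y, R i j x y = R j i y x) ->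
    (forall i j, i != j -> rich D K (R i j)) ->
    (forall i, #|T| <= a * #|A i|) ->
    exists x : Z -> T, {in s, forall i, x i \in A i} /\
      {in s &, forall i j, i != j -> R i j (x i) (x j)}.
Proof.
elim: s a => [|i s IH] a /=.
  move=> _; exists 1 => T R A; case/card_gt0P => t _ _ _ _.
  by exists (fun=> t); split.
(* Fixing the value at [i] may shrink the remaining candidate sets by a factor [D]; with [D.+1] the
   bound also covers untouched sets when [D] is 0. *)
case/andP => iNs us; have [Q HQ] := IH (a * D.+1) us.
(* Each later index excludes at most [K * a] values, and a candidate set has at least [#|T| / a]
   elements; this threshold leaves one value free. *)
exists (maxn Q (a * (size s * (K * a))).+1) => T R A; rewrite geq_max => /andP[QT lt] Rsym Rr leA.
pose bad j := [set x | D * #|[set y in A j | R i j x y]| < #|A j|].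
have T0 : 0 < #|T| by apply: leq_trans lt.
have bad_le j : j \in s -> #|bad j| <= K * a.
  move=> js; have ij : i != j by apply: contraNneq iNs => ->.
  have A0 : 0 < #|A j| by move: (leA j); case: #|A j| => //; rewrite muln0; lia.
  rewrite -(leq_pmul2r A0); apply: leq_trans (Rr _ _ ij _) _.
  by rewrite -mulnA leq_mul2l leA orbT.
have [x0 x0A x0good] : exists2 x0, x0 \in A i & forall j, j \in s -> x0 \notin bad j.
  have : ~~ (A i \subset \bigcup_(j <- s) bad j).
    apply/negP => /subset_leq_card le.
    have le2 : #|\bigcup_(j <- s) bad j| <= size s * (K * a).
      elim: (s) bad_le {le} => [|j r IHr] bl; first by rewrite big_nil cards0.
      rewrite big_cons; apply: leq_trans (leq_card_setU _ _) _; rewrite mulSn.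
      by apply: leq_add; [apply: bl; rewrite mem_head | apply: IHr => l lr; apply: bl; rewrite inE lr orbT].
    have := leA i; rewrite leqNgt => /negP; apply; apply: leq_trans lt.
    by rewrite ltnS leq_mul2l (leq_trans le le2) orbT.
  case/subsetPn => x0 x0A x0b; exists x0 => // j js; apply: contra x0b => xb.
  by rewrite (big_rem j) //= inE xb.
pose A' j := if j \in s then [set y in A j | R i j x0 y] else A j.
have [||||x [xA xR]] := HQ T R A' => //.
  move=> j; rewrite /A'; case: ifP => [js|_]; last first.
    by apply: leq_trans (leA j) _; rewrite -mulnA leq_mul2l mulSn leq_addr orbT.
  have := x0good j js; rewrite inE -leqNgt => le.
  apply: leq_trans (leA j) _; rewrite -mulnA leq_mul2l; apply/orP; right.
  by apply: leq_trans le _; rewrite leq_mul2r leqnSn orbT.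
have neqi j : j \in s -> (j == i) = false by move=> js; apply: contraNF iNs => /eqP <-.
have xA' j : j \in s -> (x j \in A j) && R i j x0 (x j).
  by move=> js; have := xA j js; rewrite /A' js inE.
exists (fun j => if j == i then x0 else x j); split=> [j|j l]; rewrite !inE.
  by case/predU1P => [->|js]; [rewrite eqxx | rewrite (neqi _ js); case/andP: (xA' j js)].
case/predU1P => [->|js] /predU1P[->|ls]; rewrite ?eqxx ?(neqi _ js) ?(neqi _ ls) //.
- by case/andP: (xA' l ls).
- by move=> _; rewrite Rsym; case/andP: (xA' j js).
- by apply: xR.
Qed.

End Embedding.

(** * Difference families *)

Lemma card_eq_bij (T T' : finType) (d : T') (A : {set T}) (B : {set T'}) :
  #|A| = #|B| -> exists f : T -> T', {in A &, injective f} /\ f @: A = B.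
Proof.
move=> AB; pose f x := nth d (enum B) (index x (enum A)).
have lt x : x \in A -> index x (enum A) < size (enum B).
  by move=> xA; rewrite -cardE -AB cardE index_mem mem_enum.
have inj : {in A &, injective f}.
  move=> x y xA yA /eqP; rewrite nth_uniq ?enum_uniq ?lt // => /eqP.
  by apply: (index_inj x); rewrite mem_enum.
exists f; split=> //; apply/eqP; rewrite eqEcard card_in_imset // AB leqnn andbT.
by apply/subsetP => y /imsetP[x xA ->]; rewrite -mem_enum mem_nth ?lt.
Qed.

Section DifferenceFamily.

Variables (F : finFieldType) (k m : nat) (b : 'I_k -> F) (g : {set 'I_k} -> F).
Local Notation e := 'C(k, 2).
Let pairs : {set {set 'I_k}} := [set P : {set 'I_k} | #|P| == 2].
Hypotheses (k_gt1 : 1 < k) (m_gt0 : 0 < m) (m_even : ~~ odd m).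
Hypotheses (cardF : #|F| = (e * m).+1).
Hypotheses (g_inj : {in pairs &, injective g}) (g_im : g @: pairs = classes F e).
Hypothesis b_class : forall i j, i != j -> ((b j - b i) ^+ m = g [set i; j])%R.

Local Open Scope ring_scope.

Let e_gt0 : (0 < e)%N.
Proof. by rewrite bin_gt0. Qed.

Let oppF_neq (x : F) : x != 0 -> - x != x.
Proof.
move=> x0; rewrite -mulN1r -[X in _ != X]mul1r; apply/eqP => /(mulIf x0) /eqP.
by apply/negP/opp1_neq1; rewrite cardF /= oddM negb_and m_even orbT.
Qed.

(* Multiplying the base block by [x] and by [- x] covers the same differences, so only one of
   them is used. *)
Let half : {set F} := [set x | (x ^+ m == 1) && (enum_rank x < enum_rank (- x))%N].

Let half_neq0 x : x \in half -> x != 0.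
Proof.
by rewrite inE => /andP[/eqP xm _]; apply: contra_eq_neq xm => ->;
  rewrite expr0n (gtn_eqF m_gt0) eq_sym oner_eq0.
Qed.

Let half_or x : x ^+ m = 1 -> (x \in half) || (- x \in half).
Proof.
move=> xm; have x0 : x != 0.
  by apply: contra_eq_neq xm => ->; rewrite expr0n (gtn_eqF m_gt0) eq_sym oner_eq0.
rewrite !inE exprNn -signr_odd (negPf m_even) expr0 mul1r xm eqxx opprK /= -neq_ltn.
apply/eqP => /val_inj /enum_rank_inj /esym /eqP.
by apply/negP/oppF_neq.
Qed.

Let half_opp x : x \in half -> - x \notin half.
Proof.
by rewrite !inE opprK => /andP[_ lt]; rewrite negb_and -leqNgt (ltnW lt) orbT.
Qed.

Let b_inj : injective b.
Proof.
move=> i j bij; apply/eqP; apply: contraT => ij.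
have : g [set i; j] \in classes F e by rewrite -g_im imset_f // inE cards2 ij.
move/(classes_neq0 e_gt0); rewrite -b_class // bij subrr expr0n (gtn_eqF m_gt0).
by rewrite eqxx.
Qed.

Definition develop (x y : F) : {set F} := [set x * b i + y | i : 'I_k].

(** The class of [v - u] determines the pair [{i, j}]. Exactly one of the two quotients of [v - u]
    by [b j - b i] and by [b i - b j] lies in [half]; this fixes the multiplier, and [u] then fixes
    the translate. *)
Lemma difference_family_design : is_design k [set develop x y | x in half, y in [set: F]].
Proof.
split=> [_ /imset2P[x y xh _ ->]|u v uv].
  rewrite card_imset ?card_ord // => i j /addIr /(mulfI (half_neq0 xh)); exact: b_inj.
have vu : v - u != 0 by rewrite subr_eq0 eq_sym.
have [i [j [x [ij xh E]]]] :
    exists i j (x : F), [/\ i != j, x \in half & v - u = x * (b j - b i)].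
  have : (v - u) ^+ m \in g @: pairs by rewrite g_im (class_in cardF).
  case/imsetP => P; rewrite inE => /cards2P[i [j [ij ->]]] clE.
  have bij : b j - b i != 0 by rewrite subr_eq0 (inj_eq b_inj) eq_sym.
  have xm : ((v - u) / (b j - b i)) ^+ m = 1.
    by rewrite expr_div_n clE b_class // divff // -b_class // expf_neq0.
  case/orP: (half_or xm) => xh.
    by exists i, j, ((v - u) / (b j - b i)); rewrite divfK.
  exists j, i, (- ((v - u) / (b j - b i))); split=> //; first by rewrite eq_sym.
  by rewrite mulNr -mulrN opprB divfK.
exists (develop x (u - x * b i)); split.
  split; first by apply/imset2P; exists x (u - x * b i).
    by apply/imsetP; exists i; rewrite // addrC subrK.
  by apply/imsetP; exists j; rewrite // -[LHS](subrK u) E; ring.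
move=> _ [/imset2P[x' y' xh' _ ->] /imsetP[i' _ uE] /imsetP[j' _ vE]].
have E' : v - u = x' * (b j' - b i') by rewrite vE uE; ring.
have ij' : i' != j' by apply: contraNneq vu => ij'; rewrite E' ij' subrr mulr0.
have : [set i; j] = [set i'; j'].
  apply: g_inj; rewrite ?inE ?cards2 ?ij ?ij' // -!b_class //.
  move: xh xh'; rewrite !inE => /andP[/eqP xm _] /andP[/eqP xm' _].
  by rewrite -[LHS]mul1r -xm -[RHS]mul1r -xm' -!exprMn -E E'.
move/setP => S.
have := S i; have := S j; rewrite !inE !eqxx orbT /= => /esym jE /esym iE.
have bij : b j - b i != 0 by rewrite subr_eq0 (inj_eq b_inj) eq_sym.
case/orP: iE => /eqP iE; case/orP: jE => /eqP jE.
- by rewrite iE jE eqxx in ij.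
- have xx : x = x' by apply: (mulIf bij); rewrite -E E' iE jE.
  by congr develop; rewrite // xx iE uE; ring.
(* The pair matched in reverse order would put both [x] and [- x] in [half]. *)
- have xx : - x = x' by apply: (mulIf bij); rewrite mulNr -E E' iE jE; ring.
  by have := half_opp xh; rewrite xx xh'.
- by rewrite iE jE eqxx in ij.
Qed.

End DifferenceFamily.

(** Wilson's construction: the pairs of indices are matched with the classes, and a base block whose
    differences have these classes is chosen greedily. Since [m] is even, the class of a difference
    does not depend on the order. *)
Lemma wilson_design (k : nat) : 1 < k -> exists Q, forall (F : finFieldType) (m : nat),
  Q <= #|F| -> 0 < m -> ~~ odd m -> #|F| = ('C(k, 2) * m).+1 ->
  exists B : {set {set F}}, is_design k B.
Proof.
move=> k1; pose e := 'C(k, 2); have e0 : 0 < e by rewrite bin_gt0.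
have [Q HQ] := rich_embedding (2 * e) (8 * e ^ 2) 1 (enum_uniq 'I_k).
exists Q => F m QF m0 m_even cardF.
pose pairs := [set P : {set 'I_k} | #|P| == 2].
have card_pairs : #|pairs| = #|classes F e|.
  by rewrite (class_counts e0 m0 cardF).1 card_draws card_ord.
have [g [g_inj g_im]] := card_eq_bij (0%R : F) card_pairs.
have [|||b [_ bP]] := HQ F (fun i j x y => (y - x) ^+ m == g [set i; j])%R (fun=> setT) QF.
- move=> i j x y; rewrite setUC -opprB exprNn -signr_odd (negPf m_even) expr0 mul1r //.
- by move=> i j ij; apply: class_rich => //; rewrite -g_im imset_f // inE cards2 ij.
- by move=> _; rewrite cardsT mul1n.
exists [set develop b x y | x in [set x | ((x ^+ m == 1) && (enum_rank x < enum_rank (- x))%N)%R], y in [set: F]].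
apply: difference_family_design g_inj g_im _ => // i j ij.
by apply/eqP/bP; rewrite ?mem_enum.
Qed.

(** For a prime [p > N], Euler's theorem makes [p ^ (totient N * Q.+1)] congruent to 1 modulo [N],
    and the factor [Q.+1] makes it large. *)
Lemma large_finField (N Q : nat) : 0 < N ->
  exists F : finFieldType, Q <= #|F| /\ N %| #|F|.-1.
Proof.
move=> N0; have [p ltp p_pr] := prime_above N.
have k0 : 0 < totient N * Q.+1 by rewrite muln_gt0 totient_gt0 N0.
have [F _ cardF] := pPrimePowerField p_pr k0; exists F; rewrite cardF; split.
  apply: leq_trans (ltnW (ltn_expl _ (prime_gt1 p_pr))).
  by apply: leq_trans (leqnSn Q) (leq_pmull _ _); rewrite totient_gt0.
have cop : coprime p N.
  by rewrite prime_coprime //; apply: contraL ltp => /(dvdn_leq N0); rewrite -leqNgt.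
rewrite -subn1 -eqn_mod_dvd ?expn_gt0 ?prime_gt0 // expnM -modnXm Euler_exp_totient //.
by rewrite modnXm exp1n.
Qed.

(** The blocks through [x], with [x] removed, partition the other points. *)
Lemma card_blocks_at (T : finType) (k : nat) (B : {set {set T}}) (x : T) :
  is_design k B -> #|[set b in B | x \in b]| * k.-1 = #|T|.-1.
Proof.
case=> sz ex; rewrite -(cardC1 x) -sum_nat_const.
transitivity (\sum_(b in [set b in B | x \in b]) #|b :\ x|).
  apply: eq_bigr => b; rewrite inE => /andP[/sz <- xb].
  by rewrite (cardsD1 x b) xb.
under eq_bigr => b _ do rewrite -sum1_card.
rewrite (exchange_big_dep (predC1 x)) /=; last by move=> b y _; rewrite !inE => /andP[].
rewrite -sum1_card; apply: eq_bigr => y yx.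
have [b [[bB xb yb] ub]] := ex x y ltac:(by rewrite eq_sym).
rewrite sum1dep_card (_ : [set _ | _] = [set b]) ?cards1 //.
apply/setP => b'; rewrite !inE; apply/idP/eqP => [/and3P[/andP[b'B xb'] _ yb']|->].
  by rewrite (ub b').
by rewrite bB xb yb yx.
Qed.

(** * Base blocks and the class function *)

Section BaseBlocks.

Variables (Z : finType) (h e : nat) (L : {set {set Z}}).
Hypotheses (L_design : is_design h L) (e_gt0 : 0 < e) (e_even : ~~ odd e).
Hypothesis L_deg : forall z, #|[set S in L | z \in S]| = e.

(** The classes that symmetric blocks already cover between [z] and [z']. For distinct [z] and [z']
    only one [S] of the design [L] contributes. *)
Definition used_classes (F : finFieldType) (m : nat) (x : {set Z} -> Z -> F) (z z' : Z) : {set F} :=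
  [set c | [exists S in L, [&& z \in S, z' \in S &
    (c == (x S z' + x S z) ^+ m) || (c == (x S z' - x S z) ^+ m)]]]%R.

(** First each [x S] is embedded with prescribed classes of its values. Its sums and differences
    take two classes for every pair of points, and the functions [y i] then realise the remaining
    [e - 2] classes, in the order of their enumeration. *)
Lemma base_blocks : exists Q, forall (F : finFieldType) (m : nat),
  Q <= #|F| -> 0 < m -> ~~ odd m -> #|F| = (e * m).+1 ->
  exists (x : {set Z} -> Z -> F) (y : 'I_(e - 2) -> Z -> F),
  [/\ forall z, {in [set S in L | z \in S] &, injective (fun S => x S z ^+ m)%R},
      forall z, [set (x S z ^+ m)%R | S in [set S in L | z \in S]] = classes F e,
      forall S z z', z != z' ->
        [&& x S z' + x S z != 0, x S z' - x S z != 0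
          & (x S z' + x S z) ^+ m != (x S z' - x S z) ^+ m]%R,
      forall z z', z != z' -> injective (fun i => (y i z' - y i z) ^+ m)%R
    & forall z z', z != z' ->
        [set ((y i z' - y i z) ^+ m)%R | i : 'I_(e - 2)] = classes F e :\: used_classes m x z z'].
Proof.
(* The density [1 / e.+1] is that of one class: it has [m] elements, and [e * m + 1 <= e.+1 * m]. *)
have [Q1 HQ1] := rich_embedding 8 128 e.+1 (enum_uniq Z).
have [Q2 HQ2] := rich_embedding (2 * e) (8 * e ^ 2) 1 (enum_uniq Z).
exists (maxn Q1 Q2) => F m; rewrite geq_max => /andP[QF1 QF2] m0 m_even cardF.
have [card_cl card_fib] := class_counts e_gt0 m0 cardF.
have opp_class (t : F) : ((- t) ^+ m = t ^+ m)%R.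
  by rewrite exprNn -signr_odd (negPf m_even) expr0 mul1r.
have /fin_all_exists [f fP] z : exists f : {set Z} -> F,
    {in [set S in L | z \in S] &, injective f} /\ f @: [set S in L | z \in S] = classes F e.
  by apply: (card_eq_bij 0%R); rewrite L_deg.
(* The default class 1 lets [x S] be chosen on all of [Z], for every set [S]. *)
pose c S z := if (S \in L) && (z \in S) then f z S else 1%R.
have cC S z : c S z \in classes F e.
  rewrite /c; case: ifP => [SLz|_]; last by rewrite inE expr1n.
  by rewrite -(fP z).2 imset_f // inE.
have /fin_all_exists [x xP] S : exists x : Z -> F, (forall z, x z ^+ m = c S z)%R /\
    forall z z', z != z' -> [&& x z' + x z != 0, x z' - x z != 0
          & (x z' + x z) ^+ m != (x z' - x z) ^+ m]%R.
  have [|||x [xA xR]] := HQ1 F (fun _ _ x y =>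
      [&& y + x != 0, y - x != 0 & (y + x) ^+ m != (y - x) ^+ m]%R)
      (fun z => [set t | (t ^+ m == c S z)%R]) QF1.
  - by move=> _ _ a b; rewrite addrC -opprB oppr_eq0 opp_class.
  - by move=> *; apply: sub_squares_rich e_even.
  - by move=> z; rewrite card_fib // cardF mulSn; lia.
  exists x; split=> [z|z z' zz']; last by apply: xR; rewrite ?mem_enum.
  by have := xA z ltac:(by rewrite mem_enum); rewrite inE => /eqP.
have xc S z : S \in [set S in L | z \in S] -> (x S z ^+ m = f z S)%R.
  by rewrite inE (xP S).1 /c => ->.
pose U := used_classes m x.
have UC z z' : U z z' = U z' z.
  apply/setP => t; rewrite !inE; apply/eq_existsb => S.
  congr (_ && _); rewrite andbCA; congr [&& _, _ & _].
  by rewrite [(x S z' + _)%R]addrC -[(x S z' - _)%R]opprB opp_class.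
(* The sum and the difference are nonzero and of different classes, so exactly two classes are
   used. *)
have card_avail z z' : z != z' -> #|classes F e :\: U z z'| = e - 2.
  move=> zz'; have [S [[SL zS z'S] uS]] := L_design.2 z z' zz'.
  have /and3P[p0 n0 pn] := (xP S).2 z z' zz'.
  have UE : U z z' = [set ((x S z' + x S z) ^+ m)%R; ((x S z' - x S z) ^+ m)%R].
    apply/setP => t; rewrite !inE; apply/existsP/idP => [[S' /and4P[S'L zS' z'S']]|tU].
      by rewrite (uS S').
    by exists S; rewrite SL zS z'S.
  have US : U z z' \subset classes F e.
    by rewrite UE; apply/subsetP => t; rewrite !inE => /orP[] /eqP ->;
      have := class_in cardF p0; have := class_in cardF n0; rewrite !inE.
  by rewrite cardsD (setIidPr US) card_cl UE cards2 pn.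
pose g i z z' : F := nth 0%R (enum (classes F e :\: U z z')) i.
have gC z z' (i : 'I_(e - 2)) : z != z' -> g i z z' \in classes F e :\: U z z'.
  by move=> zz'; rewrite -mem_enum mem_nth // -cardE card_avail.
have /fin_all_exists [y yP] (i : 'I_(e - 2)) : exists y : Z -> F,
    forall z z', z != z' -> ((y z' - y z) ^+ m = g i z z')%R.
  have [|||y [_ yR]] := HQ2 F (fun z z' x y => (y - x) ^+ m == g i z z')%R (fun=> setT) QF2.
  - by move=> z z' a b; rewrite /g UC -opprB opp_class.
  - move=> z z' zz'; apply: class_rich => //.
    by have := gC z z' i zz'; rewrite inE => /andP[].
  - by move=> _; rewrite cardsT mul1n.
  by exists y => z z' zz'; apply/eqP/yR; rewrite ?mem_enum.
exists x, y; split=> [z S S' SL SL'|z|S|z z' zz' i j|z z' zz'].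
- by rewrite !xc //; apply: (fP z).1.
- by rewrite -(fP z).2; apply: eq_in_imset => S; apply: xc.
- exact: (xP S).2.
- rewrite !yP // => /eqP; rewrite nth_uniq ?enum_uniq -?cardE ?card_avail //.
  by move/eqP/val_inj.
- apply/setP => t; apply/imsetP/idP => [[i _ ->]|tC]; first by rewrite yP // gC.
  have lt : index t (enum (classes F e :\: U z z')) < e - 2.
    by rewrite -(card_avail _ _ zz') cardE index_mem mem_enum.
  by exists (Ordinal lt) => //; rewrite yP // /g nth_index // mem_enum.
Qed.

End BaseBlocks.

(** * A class function invariant under the group *)

Section ClassFunction.

Variables (F : finFieldType) (e m : nat) (gT : finGroupType) (V : finLmodType F).
Variable act : V -> gT -> V.
Hypothesis cardF : #|F| = (e * m).+1.
Hypothesis dvd_m : #|gT| %| m.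
Hypotheses (act1 : forall v, act v 1%g = v).
Hypotheses (actM : forall v g g', act v (g * g')%g = act (act v g) g').
Hypotheses (actZ : forall a v g, act (a *: v)%R g = (a *: act v g)%R).

Local Open Scope ring_scope.

Let act0 g : act 0 g = 0. Proof. by rewrite -(scale0r 0) actZ !scale0r. Qed.

Let act_eq0 v g : (act v g == 0) = (v == 0).
Proof.
apply/eqP/eqP => [vg|->]; last exact: act0.
by rewrite -[v]act1 -(mulgV g) actM vg act0.
Qed.

Let orb v : {set V} := [set a *: act v g | a in [set~ 0], g in [set: gT]].

Let orbP v w : reflect (exists a g, a != 0 /\ w = a *: act v g) (w \in orb v).
Proof.
apply: (iffP imset2P) => [[a g]|[a [g [a0 ->]]]].
  by rewrite !inE => a0 _ ->; exists a, g.
by exists a g; rewrite ?inE.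
Qed.

Let orb_refl v : v \in orb v.
Proof. by apply/orbP; exists 1, 1%g; rewrite oner_neq0 scale1r act1. Qed.

Let orb_sub v w : w \in orb v -> orb w \subset orb v.
Proof.
case/orbP => a [g [a0 ->]]; apply/subsetP => _ /orbP[b [g' [b0 ->]]].
apply/orbP; exists (b * a), (g * g')%g; split; first by rewrite mulf_neq0.
by rewrite actZ scalerA actM.
Qed.

Let orb_sym v w : w \in orb v -> v \in orb w.
Proof.
case/orbP => a [g [a0 ->]]; apply/orbP; exists a^-1, g^-1%g; split; first by rewrite invr_neq0.
by rewrite actZ -actM mulgV act1 scalerA mulVf ?scale1r.
Qed.

Let orb_eq v w : w \in orb v -> orb w = orb v.
Proof. by move=> wv; apply/eqP; rewrite eqEsubset !orb_sub // orb_sym. Qed.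

(** The choice depends only on the orbit as a set, so it is constant on orbits; the default 0 is
    never reached by failure, since [v] lies in [orb v]. *)
Let rep v := odflt 0 [pick w in orb v].

Let rep_in v : rep v \in orb v.
Proof. by rewrite /rep; case: pickP => // /(_ v); rewrite orb_refl. Qed.

Let rep_orb v w : w \in orb v -> rep w = rep v.
Proof. by rewrite /rep => /orb_eq ->. Qed.

Let Cl v : F := if [pick a | (a != 0) && [exists g, v == a *: act (rep v) g]] is Some a
  then a ^+ m else 0.

(* If [a r] and [b r] lie in the same [gT]-orbit then [(a / b) ^ #|gT| = 1], so [a] and [b]
   are in the same class. *)
Let ClE v a g : v != 0 -> v = a *: act (rep v) g -> Cl v = a ^+ m.
Proof.
move=> v0 vE; rewrite /Cl; case: pickP => [b|/(_ a)]; last first.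
  case/negP; apply/andP; split; last by apply/existsP; exists g; apply/eqP.
  by apply: contraNneq v0 => a0; rewrite vE a0 scale0r.
case/andP => b0 /existsP[g' /eqP vE'].
set r := rep v in vE vE'.
have r0 : r != 0 by apply: contraNneq v0 => r0; rewrite vE r0 act0 scaler0.
have E : act r (g' * g^-1)%g = (a / b) *: r.
  have : b *: act r g' = a *: act r g by rewrite -vE -vE'.
  move/(congr1 (fun u => b^-1 *: act u g^-1%g)).
  by rewrite !actZ -!actM mulgV act1 !scalerA mulVf // scale1r mulrC.
have En n : act r ((g' * g^-1) ^+ n)%g = (a / b) ^+ n *: r.
  elim: n => [|n IHn]; first by rewrite expg0 act1 scale1r.
  by rewrite expgSr actM IHn actZ E scalerA exprSr.
have := En #|gT|; rewrite -cardsT expg_cardG ?inE // act1 cardsT => /eqP.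
rewrite -subr_eq0 -{1}[r]scale1r -scalerBl scaler_eq0 (negPf r0) orbF subr_eq0.
move/eqP => ab; have : (a / b) ^+ m = 1.
  by case/dvdnP: dvd_m => q ->; rewrite mulnC exprM -ab expr1n.
by rewrite expr_div_n => /(canRL (divfK (expf_neq0 _ b0))); rewrite mul1r.
Qed.

Let rep_coord v : exists a g, a != 0 /\ v = a *: act (rep v) g.
Proof. exact/orbP/orb_sym/rep_in. Qed.

(** Each nonzero orbit under scalars and [gT] is given class 1 at its representative; [ClE] makes
    the extension by scalars and group elements well defined. *)
Lemma class_function : exists Cl : V -> F,
  [/\ forall v, v != 0 -> Cl v \in classes F e,
      forall a v, a != 0 -> v != 0 -> Cl (a *: v) = a ^+ m * Cl v
    & forall v g, v != 0 -> Cl (act v g) = Cl v].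
Proof.
exists Cl; split=> [v v0|a v a0 v0|v g v0].
- have [a [g [a0 vE]]] := rep_coord v.
  by rewrite (ClE v0 vE) (class_in cardF).
- have [b [g [b0 vE]]] := rep_coord v.
  rewrite (ClE v0 vE) -exprMn; apply: (@ClE _ _ g).
    by rewrite scaler_eq0 negb_or a0.
  have -> : rep (a *: v) = rep v.
    by apply: rep_orb; apply/orbP; exists a, 1%g; rewrite act1.
  by rewrite -scalerA -vE.
- have [b [g' [b0 vE]]] := rep_coord v.
  rewrite (ClE v0 vE); apply: (@ClE _ _ (g' * g)%g); first by rewrite act_eq0.
  have -> : rep (act v g) = rep v.
    by apply: rep_orb; apply/orbP; exists 1, g; rewrite oner_neq0 scale1r.
  by rewrite actM -actZ -vE.
Qed.

End ClassFunction.

(** * The design and its automorphisms *)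

Section Transport.

Variables (T : finType) (k : nat) (B : {set {set T}}).
Variables (gT : finGroupType) (to : {action gT &-> T}).
Hypothesis B_design : is_design k B.
Hypothesis B_inv : forall g b, b \in B -> [set to t g | t in b] \in B.
Hypothesis to_faithful : forall g, (forall t, to t g = t) -> g = 1%g.

Let to_ord (i : 'I_#|T|) g := enum_rank (to (enum_val i) g).

Let to_ord1 : to_ord^~ 1%g =1 id.
Proof. by move=> i; rewrite /to_ord act1 enum_valK. Qed.

Let to_ordM i : act_morph to_ord i.
Proof. by move=> g h; rewrite /to_ord actM enum_rankK. Qed.

(** Everything is carried to an ordinal along [enum_rank]; by faithfulness the permutation
    representation is injective, so the image of [G] is isomorphic to [G]. *)
Lemma design_transport (G : {group gT}) : exists B' : {set {set 'I_#|T|}},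
  is_design k B' /\ exists H : {group {perm 'I_#|T|}}, H \subset design_aut B' /\ H \isog G.
Proof.
pose tor := TotalAction to_ord1 to_ordM.
have rankP (i : 'I_#|T|) (b : {set T}) : (i \in enum_rank @: b) = (enum_val i \in b).
  by rewrite -{1}(enum_valK i) (mem_imset _ _ enum_rank_inj).
exists [set enum_rank @: b | b : {set T} in B]; split.
  split=> [_ /imsetP[b bB ->]|i j ij]; first by rewrite (card_imset _ enum_rank_inj) (B_design.1 b).
  have [|b [[bB ib jb] ub]] := B_design.2 (enum_val i) (enum_val j); first by rewrite (inj_eq enum_val_inj).
  exists (enum_rank @: b); split; first by rewrite !rankP imset_f.
  by move=> _ [/imsetP[b' b'B ->]]; rewrite !rankP => ib' jb'; rewrite (ub b').
exists (actperm tor @* G)%G; split.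
  apply/subsetP => s /morphimP[g _ _ ->]; rewrite inE eqEcard; apply/andP; split; last first.
    by rewrite (card_imset _ (imset_inj (@perm_inj _ _))).
  apply/subsetP => _ /imsetP[_ /imsetP[b bB ->] ->]; apply/imsetP.
  exists [set to t g | t in b]; first exact: B_inv.
  rewrite -!imset_comp; apply: eq_imset => t /=.
  by rewrite actpermE /= /to_ord enum_rankK.
rewrite isog_sym; apply: sub_isog; first exact: subsetT.
rewrite ker_actperm; apply/subsetP => g gfix; rewrite inE; apply/eqP/to_faithful => t.
have /= /enum_rank_inj := astab_act gfix (in_setT (enum_rank t)).
by rewrite enum_rankK.
Qed.

End Transport.

(** * The blocks on [Z * V] and the pairs of points that they cover *)

Section Assembly.

Variables (F : finFieldType) (e m h : nat) (V : finLmodType F).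
Variables (Z : finType) (L D : {set {set Z}}).
Variables (x : {set Z} -> Z -> F) (y : 'I_(e - 2) -> Z -> F) (Cl : V -> F).

Hypotheses (e_gt0 : 0 < e) (m_gt0 : 0 < m) (m_even : ~~ odd m) (cardF : #|F| = (e * m).+1).
Hypotheses (L_design : is_design h L) (D_design : is_design h.*2 D).

Local Open Scope ring_scope.

Hypothesis x_inj : forall z, {in [set S in L | z \in S] &, injective (fun S => x S z ^+ m)}.
Hypothesis x_im : forall z, [set x S z ^+ m | S in [set S in L | z \in S]] = classes F e.
Hypothesis x_sep : forall S z z', z != z' ->
  [&& x S z' + x S z != 0, x S z' - x S z != 0
    & (x S z' + x S z) ^+ m != (x S z' - x S z) ^+ m].
Hypothesis y_inj : forall z z', z != z' -> injective (fun i => (y i z' - y i z) ^+ m).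
Hypothesis y_im : forall z z', z != z' ->
  [set (y i z' - y i z) ^+ m | i : 'I_(e - 2)] = classes F e :\: used_classes L m x z z'.
Hypothesis Cl_in : forall v, v != 0 -> Cl v \in classes F e.
Hypothesis ClZ : forall a v, a != 0 -> v != 0 -> Cl (a *: v) = a ^+ m * Cl v.

(** With this normalisation [a *: w] has class [a ^+ m] for nonzero [a], so the coefficients in the
    base blocks decide which block carries a given difference. *)
Definition directions : {set V} := [set w | (w != 0) && (Cl w == 1)].

Definition flat_block (b : {set Z}) (p : V) : {set Z * V} := [set (z, p) | z in b].

(** The Boolean is a sign: there are two points over each [z] of [S], so a block of size [h] in [L]
    yields one of size [h.*2]. *)
Definition sym_block (S : {set Z}) (p w : V) : {set Z * V} :=
  [set (t.1, p + (-1) ^+ t.2 * x S t.1 *: w) | t : Z * bool in setX S [set: bool]].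

Definition skew_block (i : 'I_(e - 2)) (b : {set Z}) (p w : V) : {set Z * V} :=
  [set (z, p + y i z *: w) | z in b].

Definition blocks : {set {set Z * V}} := [set b |
  [|| [exists d in D, exists p, b == flat_block d p],
      [exists S in L, exists p, exists w in directions, b == sym_block S p w]
    | [exists i, exists d in D, exists p, exists w in directions, b == skew_block i d p w]]].

Variant block_spec (b : {set Z * V}) : Prop :=
| FlatBlock d p of d \in D & b = flat_block d p
| SymBlock S p w of S \in L & w \in directions & b = sym_block S p w
| SkewBlock i d p w of d \in D & w \in directions & b = skew_block i d p w.

Lemma blocksP b : reflect (block_spec b) (b \in blocks).
Proof.
rewrite inE; apply: (iffP or3P) => [[]|[]].
- by case/exists_inP => d dD /existsP[p /eqP]; apply: FlatBlock.
- by case/exists_inP => S SL /existsP[p /exists_inP[w wW /eqP]]; apply: SymBlock.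
- case/existsP => i /exists_inP[d dD /existsP[p /exists_inP[w wW /eqP]]].
  exact: SkewBlock.
- move=> d p dD ->; constructor 1; apply/exists_inP; exists d => //.
  by apply/existsP; exists p.
- move=> S p w SL wW ->; constructor 2; apply/exists_inP; exists S => //.
  by apply/existsP; exists p; apply/exists_inP; exists w.
- move=> i d p w dD wW ->; constructor 3; apply/existsP; exists i.
  by apply/exists_inP; exists d => //; apply/existsP; exists p; apply/exists_inP; exists w.
Qed.

Lemma mem_flat_block z v (d : {set Z}) p : ((z, v) \in flat_block d p) = (z \in d) && (v == p).
Proof.
apply/imsetP/andP => [[z' z'd [-> ->]]|[zd /eqP ->]]; first by rewrite eqxx.
by exists z.
Qed.

Lemma sym_blockP z v (S : {set Z}) p w :
  reflect (z \in S /\ exists s : bool, v = p + (-1) ^+ s * x S z *: w) ((z, v) \in sym_block S p w).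
Proof.
apply: (iffP imsetP) => [[[z' s]]|[zS [s ->]]].
  by rewrite !inE /= andbT => z'S [-> ->]; split=> //; exists s.
by exists (z, s); rewrite // !inE zS.
Qed.

Lemma mem_skew_block z v i (d : {set Z}) p w :
  ((z, v) \in skew_block i d p w) = (z \in d) && (v == p + y i z *: w).
Proof.
apply/imsetP/andP => [[z' z'd [-> ->]]|[zd /eqP ->]]; first by rewrite eqxx.
by exists z.
Qed.

Lemma exprm_opp (a : F) : (- a) ^+ m = a ^+ m.
Proof. by rewrite exprNn -signr_odd (negPf m_even) expr0 mul1r. Qed.

Lemma class_of_direction (a : F) v w : a != 0 -> w \in directions -> v = a *: w -> Cl v = a ^+ m.
Proof. by move=> a0; rewrite inE => /andP[w0 /eqP Cw] ->; rewrite ClZ // Cw mulr1. Qed.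

Lemma direction_of_class (a : F) v : a != 0 -> v != 0 -> Cl v = a ^+ m -> a^-1 *: v \in directions.
Proof.
move=> a0 v0 Cv; rewrite inE scaler_eq0 negb_or invr_neq0 // v0 /= ClZ ?invr_neq0 //.
by rewrite Cv -exprMn mulVf // expr1n.
Qed.

Lemma opp_direction w : w \in directions -> - w \in directions.
Proof.
rewrite !inE oppr_eq0 => /andP[w0 Cw]; rewrite w0 /= -scaleN1r ClZ ?oppr_eq0 ?oner_eq0 //.
by rewrite exprm_opp expr1n mul1r.
Qed.

Lemma sym_blockN S p w : sym_block S p (- w) = sym_block S p w.
Proof.
apply/setP => -[z v]; apply/sym_blockP/sym_blockP => -[zS [s vE]]; split=> //; exists (~~ s).
  by rewrite vE scalerN -scaleNr signrN !mulNr.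
by rewrite vE scalerN -scaleNr signrN !mulNr opprK.
Qed.

(* A symmetric block is unchanged when its direction is negated, so any of its points may be
   assumed to carry the sign [+]. *)
Lemma sym_block_at z v (S : {set Z}) p w : w \in directions -> (z, v) \in sym_block S p w ->
  exists w', [/\ w' \in directions, sym_block S p w = sym_block S p w', z \in S
    & v = p + x S z *: w'].
Proof.
move=> wW /sym_blockP[zS [[] vE]]; last by exists w; rewrite vE expr0 mul1r.
exists (- w); split; rewrite ?opp_direction ?sym_blockN //.
by rewrite vE expr1 mulN1r scaleNr scalerN.
Qed.

Lemma x_neq0 (S : {set Z}) z : S \in L -> z \in S -> x S z != 0.
Proof.
move=> SL zS; apply: (class_neq0 e_gt0 m_gt0); rewrite -(x_im z).
by apply: imset_f; rewrite inE SL.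
Qed.

Lemma double_neq0 (a : F) : a != 0 -> a *+ 2 != 0.
Proof.
move=> a0; rewrite -mulr_natr mulf_neq0 //.
have -> : 2%:R = 1 - (-1) :> F by rewrite opprK.
by rewrite subr_eq0 eq_sym opp1_neq1 // cardF /= oddM negb_and m_even orbT.
Qed.

(** Once the point over [z] has sign +, [s] is the sign of the point over [z'], and the left side is
    the class of their difference. The evenness of [m] removes the overall sign. *)
Lemma signed_diff_class S z z' (s : bool) : z != z' ->
  ((-1) ^+ s * x S z' - x S z) ^+ m =
    if s then (x S z' + x S z) ^+ m else (x S z' - x S z) ^+ m.
Proof.
case: s; last by rewrite expr0 mul1r.
by rewrite expr1 mulN1r -opprD exprm_opp.
Qed.

Lemma signed_diff_neq0 S z z' (s : bool) : z != z' -> (-1) ^+ s * x S z' - x S z != 0.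
Proof.
move=> /(x_sep S)/and3P[p0 n0 _]; case: s; last by rewrite expr0 mul1r.
by rewrite expr1 mulN1r -opprD oppr_eq0.
Qed.

Lemma y_diff_class i z z' : z != z' ->
  (y i z' - y i z) ^+ m \in classes F e :\: used_classes L m x z z'.
Proof. by move=> zz'; rewrite -y_im //; apply: imset_f. Qed.

Lemma y_diff_neq0 i z z' : z != z' -> y i z' - y i z != 0.
Proof.
by move/(y_diff_class i); rewrite inE => /andP[_]; apply: (class_neq0 e_gt0 m_gt0).
Qed.

Lemma card_block b : b \in blocks -> #|b| = h.*2.
Proof.
case/blocksP => [d p dD ->|S p w SL wW ->|i d p w dD wW ->].
- by rewrite card_imset ?(D_design.1 d) // => z z' [].
- rewrite card_in_imset ?cardsX ?(L_design.1 S) ?cardsT ?card_bool ?muln2 //.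
  case=> [z s] [z' s']; rewrite !inE /= !andbT => zS _ [<- /addrI /eqP].
  rewrite -subr_eq0 -scalerBl -mulrBl !scaler_eq0 mulf_eq0 (negPf (x_neq0 SL zS)) orbF.
  move: wW; rewrite inE => /andP[/negPf -> _]; rewrite orbF subr_eq0.
  have N1 : (-1 == 1 :> F) = false.
    by apply/negbTE/opp1_neq1; rewrite cardF /= oddM negb_and m_even orbT.
  by case: s s' => -[] //; rewrite expr0 expr1 ?[1 == _]eq_sym N1.
- by rewrite card_imset ?(D_design.1 d) // => z z' [].
Qed.

(** Only a symmetric block has two points over the same [z]. With the first sign taken as +, their
    difference is [- 2 x_S(z) w]; its class, divided by that of 2, selects [S], and then [w] and [p]
    are determined. *)
Lemma pure_pair z v v' : v != v' ->
  exists! b, [/\ b \in blocks, (z, v) \in b & (z, v') \in b].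
Proof.
move=> vv'; have d0 : v' - v != 0 by rewrite subr_eq0 eq_sym.
have two0 := double_neq0 (oner_neq0 F).
have : Cl (v' - v) / (1 *+ 2) ^+ m \in classes F e.
  rewrite inE expr_div_n -exprM mulnC (expf_pred_card cardF) // divr1.
  by have := Cl_in d0; rewrite inE.
rewrite -(x_im z) => /imsetP[S]; rewrite inE => /andP[SL zS] xE.
have x0 := x_neq0 SL zS.
have ClE : Cl (v' - v) = (- (x S z *+ 2)) ^+ m.
  rewrite exprm_opp -[X in X *+ 2]mulr1 -mulrnAr exprMn -xE divfK //.
  by rewrite expf_neq0.
have nx0 : - (x S z *+ 2) != 0 by rewrite oppr_eq0 double_neq0.
set w := (- (x S z *+ 2))^-1 *: (v' - v).
have dE : v' - v = - (x S z *+ 2) *: w by rewrite scalerA divff // scale1r.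
exists (sym_block S (v - x S z *: w) w); split.
  split; first by apply/blocksP/SymBlock; last by []; rewrite ?direction_of_class.
    by apply/sym_blockP; split=> //; exists false; rewrite expr0 mul1r subrK.
  apply/sym_blockP; split=> //; exists true.
  have {1}-> : v' = v + - (x S z *+ 2) *: w by rewrite -dE addrC subrK.
  by rewrite expr1 mulN1r -addrA -scaleNr -scalerDl mulr2n opprD.
move=> _ [/blocksP[d p dD ->|S' p w' S'L w'W ->|i d p w' dD w'W ->]].
- by rewrite !mem_flat_block => /andP[_ /eqP vE] /andP[_ /eqP v'E]; rewrite vE v'E eqxx in vv'.
- case/(sym_block_at w'W) => {w'W} w1 [w1W -> zS' vE] /sym_blockP[_ [s v'E]].
  case: s v'E => v'E; last by rewrite vE v'E expr0 mul1r eqxx in vv'.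
  have dE' : v' - v = - (x S' z *+ 2) *: w1.
    rewrite v'E vE expr1 mulN1r opprD addrACA subrr add0r -scaleNr -scalerDl.
    by congr (_ *: _); rewrite mulr2n opprD.
  have nx0' : - (x S' z *+ 2) != 0 by rewrite oppr_eq0 double_neq0 // (x_neq0 S'L).
  have SS : S = S'.
    apply: (x_inj (z := z)); rewrite ?inE ?SL ?S'L //.
    apply: (mulIf (expf_neq0 m two0)); rewrite -!exprMn !mulrnAr !mulr1.
    by rewrite -[LHS]exprm_opp -[RHS]exprm_opp -ClE (class_of_direction nx0' w1W dE').
  subst S'.
  have ww : w = w1 by rewrite /w dE' scalerA mulVf // scale1r.
  by rewrite -ww {1}vE -ww addrK.
- by rewrite !mem_skew_block => /andP[_ /eqP vE] /andP[_ /eqP v'E]; rewrite vE v'E eqxx in vv'.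
Qed.

(** In a symmetric or skew block two points over different [z] differ by a nonzero multiple of [w],
    so only a flat block can contain the pair. *)
Lemma flat_pair z z' v : z != z' ->
  exists! b, [/\ b \in blocks, (z, v) \in b & (z', v) \in b].
Proof.
move=> zz'; have [d [[dD zd z'd] ud]] := D_design.2 z z' zz'.
exists (flat_block d v); split.
  split; [apply/blocksP/(FlatBlock (p := v) dD) => // | by rewrite mem_flat_block zd eqxx | by rewrite mem_flat_block z'd eqxx].
move=> _ [/blocksP[d' p d'D ->|S' p w' S'L w'W ->|i d' p w' d'D w'W ->]].
- by rewrite !mem_flat_block => /andP[zd' /eqP ->] /andP[z'd' _]; rewrite (ud d').
- case/(sym_block_at w'W) => {w'W} w1 [w1W -> zS' ->] /sym_blockP[_ [s /addrI /eqP]].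
  rewrite eq_sym -subr_eq0 -scalerBl scaler_eq0 (negPf (signed_diff_neq0 _ _ zz')) /=.
  by move: w1W; rewrite inE => /andP[/negPf ->].
- rewrite !mem_skew_block => /andP[_ /eqP ->] /andP[_ /eqP /addrI /eqP].
  rewrite eq_sym -subr_eq0 -scalerBl scaler_eq0 (negPf (y_diff_neq0 _ zz')) /=.
  by move: w'W; rewrite inE => /andP[/negPf ->].
Qed.

(** The class of [v' - v] decides the kind of block. A used class gives the symmetric block on the
    [S] through [z] and [z'] and fixes the sign; any other class gives a single skew index [i], on
    the block of [D] through [z] and [z']. *)
Lemma mixed_pair z z' v v' : z != z' -> v != v' ->
  exists! b, [/\ b \in blocks, (z, v) \in b & (z', v') \in b].
Proof.
move=> zz' vv'; have d0 : v' - v != 0 by rewrite subr_eq0 eq_sym.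
have [S [[SL zS z'S] uS]] := L_design.2 z z' zz'.
have [d [[dD zd z'd] ud]] := D_design.2 z z' zz'.
pose a (s : bool) := (-1) ^+ s * x S z' - x S z.
have a0 s : a s != 0 by apply: signed_diff_neq0.
have a_inj s s' : a s ^+ m = a s' ^+ m -> s = s'.
  have /and3P[_ _ ne] := x_sep S zz'.
  rewrite /a !signed_diff_class //; case: s s' => -[] // /eqP; first by rewrite (negPf ne).
  by rewrite eq_sym (negPf ne).
have usedP : reflect (exists s, Cl (v' - v) = a s ^+ m) (Cl (v' - v) \in used_classes L m x z z').
  rewrite inE; apply: (iffP exists_inP) => [[S' S'L /and3P[zS' z'S']]|[s CE]].
    by rewrite -(uS S') // => /orP[] /eqP ->; [exists true | exists false]; rewrite /a signed_diff_class.
  exists S => //; rewrite zS z'S CE /a signed_diff_class //.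
  by case: (s); rewrite eqxx ?orbT.
have symP p w : w \in directions -> (z, v) \in sym_block S p w -> (z', v') \in sym_block S p w ->
    exists w' s, [/\ w' \in directions, sym_block S p w = sym_block S p w',
                     v = p + x S z *: w' & v' - v = a s *: w'].
  move=> wW /(sym_block_at wW)[w' [w'W -> _ vE]] /sym_blockP[_ [s v'E]].
  exists w', s; split=> //.
  by rewrite v'E {1}vE opprD addrACA subrr add0r -scalerBl.
have [/usedP[s CE]|unused] := boolP (Cl (v' - v) \in used_classes L m x z z').
  set w := (a s)^-1 *: (v' - v).
  have dE : v' - v = a s *: w by rewrite scalerA divff // scale1r.
  exists (sym_block S (v - x S z *: w) w); split.
    split; first by apply/blocksP/SymBlock; last by []; rewrite ?direction_of_class.
      by apply/sym_blockP; split=> //; exists false; rewrite expr0 mul1r subrK.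
    apply/sym_blockP; split=> //; exists s.
    have {1}-> : v' = v + a s *: w by rewrite -dE addrC subrK.
    by rewrite -addrA -scaleNr -scalerDl; congr (_ + _ *: _); rewrite addrC.
  move=> _ [/blocksP[d' p d'D ->|S' p w' S'L w'W ->|i d' p w' d'D w'W ->]].
  - by rewrite !mem_flat_block => /andP[_ /eqP vE] /andP[_ /eqP v'E]; rewrite vE v'E eqxx in vv'.
  - move=> vb v'b; have SS : S = S' by apply: uS; case/sym_blockP: vb; case/sym_blockP: v'b.
    subst S'; have [w1 [s1 [w1W -> vE dE1]]] := symP _ _ w'W vb v'b.
    have ss : s = s1 by apply: a_inj; rewrite -CE (class_of_direction (a0 s1) w1W dE1).
    subst s1; have ww : w = w1 by rewrite /w dE1 scalerA mulVf // scale1r.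
    by rewrite -ww {1}vE -ww addrK.
  - rewrite !mem_skew_block => /andP[_ /eqP vE] /andP[_ /eqP v'E].
    have dE1 : v' - v = (y i z' - y i z) *: w'.
      by rewrite vE v'E opprD addrACA subrr add0r -scalerBl.
    have := y_diff_class i zz'; rewrite inE -(class_of_direction (y_diff_neq0 i zz') w'W dE1).
    by case/andP => /negP []; apply/usedP; exists s.
have : Cl (v' - v) \in classes F e :\: used_classes L m x z z' by rewrite inE unused Cl_in.
rewrite -y_im // => /imsetP[i _ CE].
have b0 := y_diff_neq0 i zz'; set w := (y i z' - y i z)^-1 *: (v' - v).
have dE : v' - v = (y i z' - y i z) *: w by rewrite scalerA divff // scale1r.
exists (skew_block i d (v - y i z *: w) w); split.
  split; first by apply/blocksP/SkewBlock; last by []; rewrite ?direction_of_class.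
    by rewrite mem_skew_block zd subrK eqxx.
  have {1}-> : v' = v + (y i z' - y i z) *: w by rewrite -dE addrC subrK.
  by rewrite mem_skew_block z'd -addrA -scaleNr -scalerDl [- _ + _]addrC eqxx.
move=> _ [/blocksP[d' p d'D ->|S' p w' S'L w'W ->|i' d' p w' d'D w'W ->]].
- by rewrite !mem_flat_block => /andP[_ /eqP vE] /andP[_ /eqP v'E]; rewrite vE v'E eqxx in vv'.
- move=> vb v'b; have SS : S = S' by apply: uS; case/sym_blockP: vb; case/sym_blockP: v'b.
  subst S'; have [w1 [s1 [w1W _ _ dE1]]] := symP _ _ w'W vb v'b.
  by case/usedP: unused; exists s1; apply: class_of_direction w1W dE1.
- rewrite !mem_skew_block => /andP[zd' /eqP vE] /andP[z'd' /eqP v'E].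
  have dE1 : v' - v = (y i' z' - y i' z) *: w'.
    by rewrite vE v'E opprD addrACA subrr add0r -scalerBl.
  have ii : i = i'.
    by apply: (y_inj zz'); rewrite /= -CE (class_of_direction (y_diff_neq0 i' zz') w'W dE1).
  subst i'; have ww : w = w' by rewrite /w dE1 scalerA mulVf // scale1r.
  by rewrite (ud d') // {1}vE ww addrK.
Qed.

Lemma blocks_design : is_design h.*2 blocks.
Proof.
split=> [|[z v] [z' v']]; first exact: card_block.
rewrite xpair_eqE negb_and.
have [<- /= vv'|zz' _] := eqVneq z z'; first exact: pure_pair.
by have [<-|vv'] := eqVneq v v'; [apply: flat_pair | apply: mixed_pair].
Qed.

Variable f : V -> V.
Hypotheses (f_inj : injective f) (fD : {morph f : u v / u + v}).
Hypotheses (fZ : forall a v, f (a *: v) = a *: f v) (Cl_f : forall v, v != 0 -> Cl (f v) = Cl v).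

(** A linear [f] preserving [Cl] sends directions to directions, so a block keeps its kind and its
    base block while [p] and [w] are replaced by their images. *)
Lemma blocks_invariant b : b \in blocks -> [set (t.1, f t.2) | t in b] \in blocks.
Proof.
have fW w : w \in directions -> f w \in directions.
  have f0 : f 0 = 0 by rewrite -(scale0r 0) fZ !scale0r.
  by rewrite !inE -{2}f0 (inj_eq f_inj) => /andP[w0 Cw]; rewrite w0 Cl_f.
case/blocksP => [d p dD ->|S p w SL wW ->|i d p w dD wW ->]; apply/blocksP.
- by apply: (@FlatBlock _ d (f p)) => //; rewrite -imset_comp.
- apply: (@SymBlock _ S (f p) (f w)); rewrite ?fW // -imset_comp.
  by apply: eq_imset => t /=; rewrite fD fZ.
- apply: (@SkewBlock _ i d (f p) (f w)); rewrite ?fW // -imset_comp.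
  by apply: eq_imset => t /=; rewrite fD fZ.
Qed.

End Assembly.

(** * The regular representation of the group *)

Section RegularAction.

Variables (F : finFieldType) (gT : finGroupType).
Local Notation V := 'rV[F]_#|gT|.
Local Open Scope ring_scope.

(** Row vectors encode functions on [gT]; left translation of the argument composes as a right
    action. *)
Definition regular_act (v : V) (g : gT) : V :=
  \row_j v 0 (enum_rank (g * enum_val j)%g).

Lemma regular_act1 v : regular_act v 1%g = v.
Proof. by apply/rowP => j; rewrite mxE mul1g enum_valK. Qed.

Lemma regular_actM v g g' : regular_act v (g * g')%g = regular_act (regular_act v g) g'.
Proof. by apply/rowP => j; rewrite !mxE enum_rankK mulgA. Qed.

Lemma regular_actD g : {morph regular_act^~ g : u v / u + v}.
Proof. by move=> u v; apply/rowP => j; rewrite !mxE. Qed.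

Lemma regular_actZ a v g : regular_act (a *: v) g = a *: regular_act v g.
Proof. by apply/rowP => j; rewrite !mxE. Qed.

Lemma regular_act_faithful g : (forall v, regular_act v g = v) -> g = 1%g.
Proof.
move/(_ (\row_j (enum_val j == 1%g)%:R))/rowP/(_ (enum_rank 1%g)); rewrite !mxE !enum_rankK.
rewrite mulg1 eqxx => /eqP; have [//|_] := eqVneq g 1%g.
by rewrite eq_sym oner_eq0.
Qed.

End RegularAction.

Theorem theorem1p3 (k : nat) (gT : finGroupType) (G : {group gT})
  (k_ge4 : 4 <= k) (k_even : ~~ odd k) (G_even : ~~ odd #|G|)
  (G_prime_powers : forall p e : nat, prime p -> 0 < e -> p ^ e %| #|G| ->
     (p ^ e %| k) || coprime (p ^ e) (k * (k - 1))) :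
  forall N : nat, exists v : nat, N < v /\
    exists B : {set {set 'I_v}}, is_design k B /\
      exists H : {group {perm 'I_v}}, H \subset design_aut B /\ H \isog G.
Proof.
move=> N {G_even G_prime_powers}.
have [h kE] : exists h, k = h.*2 by exists k./2; rewrite even_halfK.
have h1 : 1 < h by rewrite -ltn_double -kE; apply: leq_trans k_ge4.
have k1 : 1 < k by apply: leq_trans k_ge4.
have [Q1 HQ1] := wilson_design h1; have [Q2 HQ2] := wilson_design k1.
have ch0 : 0 < 'C(h, 2) by rewrite bin_gt0.
have ck0 : 0 < 'C(k, 2) by rewrite bin_gt0.
have h0 : 0 < h.-1 by rewrite -ltnS prednK // ltnW.
(* The binomial factors, each with a factor 2 for even [m], give [L] and [D] on the same [Z]. With
   the factor [h.-1] the number [e] of blocks of [L] through a point is even as well. *)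
have [|Z [QZ /dvdnP[t tE]]] := @large_finField (2 * 'C(h, 2) * 'C(k, 2) * h.-1) (maxn Q1 Q2).
  by rewrite !muln_gt0 ch0 ck0.
have Z1 := card_finNzRing_gt1 Z.
have cardZ : #|Z| = (t * (2 * 'C(h, 2) * 'C(k, 2) * h.-1)).+1 by rewrite -tE prednK // ltnW.
have t0 : 0 < t by move: Z1; rewrite cardZ ltnS muln_gt0 => /andP[].
move: QZ; rewrite geq_max => /andP[Q1Z Q2Z].
have [|||L L_design] := HQ1 Z (2 * ('C(k, 2) * h.-1 * t)) Q1Z.
- by rewrite !muln_gt0 ck0 h0 t0.
- by rewrite oddM.
- by rewrite cardZ; congr _.+1; ring.
have [|||D D_design] := HQ2 Z (2 * ('C(h, 2) * h.-1 * t)) Q2Z.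
- by rewrite !muln_gt0 ch0 h0 t0.
- by rewrite oddM.
- by rewrite cardZ; congr _.+1; ring.
pose e := 2 * ('C(h, 2) * 'C(k, 2) * t).
have e0 : 0 < e by rewrite !muln_gt0 ch0 ck0 t0.
have e_even : ~~ odd e by rewrite oddM.
have L_deg z : #|[set S in L | z \in S]| = e.
  apply/eqP; rewrite -(eqn_pmul2r h0) (card_blocks_at z L_design) cardZ /e /=.
  by apply/eqP; ring.
have [Q3 HQ3] := base_blocks L_design e0 e_even L_deg.
have gT0 : 0 < #|gT| by apply/card_gt0P; exists 1%g.
(* [Q3] depends on [Z] and [L], so [F] is chosen second. The factor [2 * #|gT|] makes [m] even and
   divisible by the group order, and [N.+1] forces more than [N] points. *)
have [|F [QF /dvdnP[u uE]]] := @large_finField (e * (2 * #|gT|)) (maxn Q3 N.+1).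
  by rewrite muln_gt0 e0 muln_gt0 gT0.
have F1 := card_finNzRing_gt1 F.
pose m := 2 * (#|gT| * u).
have cardF : #|F| = (e * m).+1.
  by rewrite -[LHS]prednK ?(ltnW F1) // uE /m; congr _.+1; ring.
have m0 : 0 < m by move: F1; rewrite cardF ltnS muln_gt0 => /andP[].
have m_even : ~~ odd m by rewrite oddM.
have dvd_m : #|gT| %| m by rewrite /m mulnCA dvdn_mulr.
move: QF; rewrite geq_max => /andP[Q3F NF].
have [x [y [x_inj x_im x_sep y_inj y_im]]] := HQ3 F m Q3F m0 m_even cardF.
pose act := @regular_act F gT.
have act1 := @regular_act1 F gT; have actM := @regular_actM F gT.
have [Cl [Cl_in ClZ Cl_act]] :=
  class_function cardF dvd_m act1 actM (@regular_actZ F gT).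
(* The group fixes the [Z] coordinate and acts linearly on the vectors. *)
pose to (s : Z * 'rV[F]_#|gT|) g := (s.1, act s.2 g).
have to1 : to^~ 1%g =1 id by case=> z v; rewrite /to /act act1.
have toM s : act_morph to s by move=> g g'; rewrite /to /act actM.
rewrite kE in D_design *.
have design :=
  blocks_design e0 m0 m_even cardF L_design D_design x_inj x_im x_sep y_inj y_im Cl_in ClZ.
exists #|{: Z * 'rV[F]_#|gT|}|; split.
  rewrite card_prod card_mx mul1n; apply: leq_trans NF _.
  apply: leq_trans (leq_pmull _ (ltnW Z1)).
  by rewrite -[X in X <= _]expn1 leq_pexp2l // ltnW.
apply: (design_transport (to := TotalAction to1 toM) design) => [g b bB|g gfix].
  apply: (blocks_invariant (f := act^~ g)) bB.
  - by move=> v v' /(congr1 (act^~ g^-1%g)); rewrite /act -!actM mulgV !act1.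
  - exact: regular_actD.
  - by move=> a v; apply: regular_actZ.
  - by move=> v; apply: Cl_act.
apply: (@regular_act_faithful F) => v.
by have [] := gfix (0%R, v).
Qed.
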